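(* Let $p\ge1$ and let $U^p(\Omega)$ be an $H^1$-conforming polynomial basis on the unit tetrahedron $\Omega$, split into vertex, edge, face and cell base functions $\mathcal V^p_i,\mathcal E^p_j,\mathcal F^p_k,\mathcal C^p_{1234}$. Let $$\mathcal T_1=\{-\mathbf e_1,\mathbf e_2,-\mathbf e_3\},\ \mathcal T_2=\{\mathbf e_3-\mathbf e_1,\mathbf e_2-\mathbf e_3,-\mathbf e_3\},$$ $$\mathcal T_3=\{\mathbf e_2-\mathbf e_1,\mathbf e_2-\mathbf e_3,-\mathbf e_2\},\ \mathcal T_4=\{\mathbf e_2-\mathbf e_1,\mathbf e_1-\mathbf e_3,-\mathbf e_1\},$$ $$\mathcal T_{12}=\{-\mathbf e_1,\mathbf e_2,\mathbf e_3\},\ \mathcal T_{13}=\{-\mathbf e_1,-\mathbf e_3,\mathbf e_2\},\ \mathcal T_{14}=\{\mathbf e_2,-\mathbf e_3,\mathbf e_1\},$$ $$\mathcal T_{23}=\{\mathbf e_3-\mathbf e_1,-\mathbf e_3,\mathbf e_2-\mathbf e_3\},\ \mathcal T_{24}=\{\mathbf e_2-\mathbf e_3,-\mathbf e_3,\mathbf e_1-\mathbf e_3\},\ \mathcal T_{34}=\{\mathbf e_2-\mathbf e_3,-\mathbf e_2,\mathbf e_1-\mathbf e_2\},$$ $$\mathcal T_{123}=\{-\mathbf e_1,\mathbf e_3,\mathbf e_2\},\ \mathcal T_{124}=\{\mathbf e_2,\mathbf e_3,\mathbf e_1\},\ \mathcal T_{134}=\{-\mathbf e_3,\mathbf e_2,\mathbf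 e_1\},$$ $$\mathcal T_{234}=\{-\mathbf e_3,\mathbf e_2-\mathbf e_3,\mathbf e_1-\mathbf e_3\},\ \mathcal T_{1234}=\{\mathbf e_3,\mathbf e_2,\mathbf e_1\}.$$ Then, under contravariant Piola transformations, the basis $$\Big\{\bigoplus_{i=1}^4\mathcal V_i^p\otimes\mathcal T_i\Big\}\oplus\Big\{\bigoplus_{j\in\mathcal J}\mathcal E^p_j\otimes\mathcal T_j\Big\}\oplus\Big\{\bigoplus_{k\in\mathcal K}\mathcal F^p_k\otimes\mathcal T_k\Big\}\oplus\{\mathcal C^p_{1234}\otimes\mathcal T_{1234}\},$$ with $\mathcal J=\{(1,2),(1,3),(1,4),(2,3),(2,4),(3,4)\}$ and $\mathcal K=\{(1,2,3),(1,2,4),(1,3,4),(2,3,4)\}$, spans an $H(\mathrm{div})$-conforming subspace.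
   Context: $\Omega=\{(\xi,\eta,\zeta)\in[0,1]^3\mid \xi+\eta+\zeta\le1\}$ has vertices $v_1=(0,0,0)$, $v_2=(0,0,1)$, $v_3=(0,1,0)$, $v_4=(1,0,0)$, edges $e_{ij}$ joining $v_i,v_j$, faces $f_{ijk}$ with vertices $v_i,v_j,v_k$, and cell $c_{1234}$. $\mathbf e_1,\mathbf e_2,\mathbf e_3$ is the Cartesian basis. $P^p(\Omega)$ denotes the polynomials of total degree at most $p$. $H^1$-conforming polynomial basis $U^p(\Omega)$: linearly independent polynomials in $P^p(\Omega)$ with $\dim U^p(\Omega)=\dim P^p(\Omega)=(p+3)(p+2)(p+1)/6$, each associated with one polytope: one vertex base function per vertex ($\mathcal V^p_i$), $p-1$ edge base functions per edge ($\mathcal E^p_j$), $(p-2)(p-1)/2$ face base functions per face ($\mathcal F^p_k$), and $(p-3)(p-2)(p-1)/6$ cell base functions ($\mathcal C^p_{1234}$). A vertex base function vanishes at all other vertices and on non-neighbouring edges and faces; an edge base function vanishes on all other edges and non-neighbouring faces; a face base function vanishes on all other faces; a cell base function vanishes on the boundary. Being $H^1$-conforming means that, after mapping to the elements of a mesh by $n\mapsto n\circ\mathbf x_e^{-1}$ and identifying corresponding base functions of shared vertices, edges and faces, the assembled functions are continuous across element interfaces. $\mathcal S\otimes\mathcal T_\ast$ denotes all products $n\boldsymbol\ell$ with $n\in\mathcal S$, $\boldsymbol\ell\in\mathcal T_\ast$. Association of the products $n\boldsymbol\ell$. To a face $f_{ijk}$: $n\in\mathcal V^p_a,\boldsymbol\ell\in\mathcal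 T_a$ for a vertex $v_a$ of the face, or $n\in\mathcal E^p_{ab},\boldsymbol\ell\in\mathcal T_{ab}$ for an edge $e_{ab}$ of the face, or $n\in\mathcal F^p_{ijk},\boldsymbol\ell\in\mathcal T_{ijk}$, in each case with $\boldsymbol\ell$ of non-vanishing normal component on $f_{ijk}$. To the cell: $n\in\mathcal E^p_{ab}$ and $\boldsymbol\ell\in\mathcal T_{ab}$ with vanishing normal component on both faces containing $e_{ab}$; or $n\in\mathcal F^p_{ijk}$ and $\boldsymbol\ell\in\mathcal T_{ijk}$ with vanishing normal component on $f_{ijk}$; or $n\in\mathcal C^p_{1234}$, $\boldsymbol\ell\in\mathcal T_{1234}$. Meshes: $V\subset\mathbb R^3$ is decomposed into a conforming tetrahedral mesh with elements $V_e=\mathbf x_e(\Omega)$, with invertible element maps $\mathbf x_e$ (e.g. affine) with Jacobian matrix $\mathbf J_e$, chosen so that the local vertex order agrees on shared edges and faces. The contravariant Piola transformation maps a reference field $\boldsymbol\phi$ to $\boldsymbol\varphi=\frac1{\det\mathbf J_e}\mathbf J_e\,\boldsymbol\phi\circ\mathbf x_e^{-1}$ (signed determinant). $H(\mathrm{div},V)=\{\mathbf u\in[L^2(V)]^3\mid\mathrm{div}\,\mathbf u\in L^2(V)\}$. ''$H(\mathrm{div})$-conforming'' means: identifying corresponding mapped base functions of shared faces (and extending cell base functions by zero), the resulting piecewise space is a subspace of $H(\mathrm{div},V)$, equivalently the jump of the normal trace $\langle\mathbf n,\mathbf u\rangle$ vanishes on every element interface. *)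

(* Defs.v *)
From HB Require Import structures.
From mathcomp Require Import all_boot all_order all_algebra.
From mathcomp Require Import all_classical all_reals all_analysis.
(* The notations of multinomials clash with those of MathComp-Analysis. *)
From mathcomp Require Import -(notations) mpoly.

Set Implicit Arguments.
Unset Strict Implicit.
Unset Printing Implicit Defensive.

Import Order.TTheory GRing.Theory Num.Theory.
Import numFieldNormedType.Exports.

Local Open Scope classical_set_scope.
Local Open Scope ring_scope.

Notation poly3 R := (mpoly.mpoly 3 R).

Section Tetrahedron.
Variable R : realType.

Definition dot (x y : 'rV[R]_3) : R := \sum_(i < 3) x 0 i * y 0 i.

Definition e1 : 'rV[R]_3 := delta_mx 0 (@Ordinal 3 0 isT).
Definition e2 : 'rV[R]_3 := delta_mx 0 (@Ordinal 3 1 isT).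
Definition e3 : 'rV[R]_3 := delta_mx 0 (@Ordinal 3 2 isT).

Definition Omega : set 'rV[R]_3 :=
  [set x | (forall i, 0 <= x 0 i) /\ \sum_(i < 3) x 0 i <= 1].

(* Vertices are numbered from 0: [vertex i] is v_(i+1). *)
Definition vertex (i : 'I_4) : 'rV[R]_3 := nth 0 [:: 0; e3; e2; e1] i.

(* A polytope of the tetrahedron (vertex, edge, face or cell) is given by the
   nonempty set s of its vertices. The empty set has an empty hull and carries
   no base function, so that it plays no role. *)
Definition weights (s : {set 'I_4}) (l : 'I_4 -> R) : Prop :=
  [/\ forall i, 0 <= l i, forall i, i \notin s -> l i = 0 &
      \sum_(i < 4) l i = 1].

Definition hull (s : {set 'I_4}) : set 'rV[R]_3 :=
  [set \sum_(i < 4) l i *: vertex i | l in weights s].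

(* The template T_s, indexed by the increasing list of the numbers (from 1) of
   the vertices of s. *)
Definition templates (s : {set 'I_4}) : seq 'rV[R]_3 :=
  match [seq (val i).+1 | i <- enum s] with
  | [:: 1%N] => [:: - e1; e2; - e3]
  | [:: 2%N] => [:: e3 - e1; e2 - e3; - e3]
  | [:: 3%N] => [:: e2 - e1; e2 - e3; - e2]
  | [:: 4%N] => [:: e2 - e1; e1 - e3; - e1]
  | [:: 1%N; 2%N] => [:: - e1; e2; e3]
  | [:: 1%N; 3%N] => [:: - e1; - e3; e2]
  | [:: 1%N; 4%N] => [:: e2; - e3; e1]
  | [:: 2%N; 3%N] => [:: e3 - e1; - e3; e2 - e3]
  | [:: 2%N; 4%N] => [:: e2 - e3; - e3; e1 - e3]
  | [:: 3%N; 4%N] => [:: e2 - e3; - e2; e1 - e2]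
  | [:: 1%N; 2%N; 3%N] => [:: - e1; e3; e2]
  | [:: 1%N; 2%N; 4%N] => [:: e2; e3; e1]
  | [:: 1%N; 3%N; 4%N] => [:: - e3; e2; e1]
  | [:: 2%N; 3%N; 4%N] => [:: - e3; e2 - e3; e1 - e3]
  | [:: 1%N; 2%N; 3%N; 4%N] => [:: e3; e2; e1]
  | _ => [::]
  end.

Definition template (s : {set 'I_4}) (t : 'I_3) : 'rV[R]_3 :=
  nth 0 (templates s) t.

(* The number of base functions of U^p associated with the polytope s. *)
Definition nbase (p : nat) (s : {set 'I_4}) : nat :=
  match #|s| with
  | 1%N => 1
  | 2%N => p - 1
  | 3%N => (p - 2) * (p - 1) %/ 2
  | 4%N => (p - 3) * (p - 2) * (p - 1) %/ 6
  | _ => 0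
  end.

Definition eval (n : poly3 R) (x : 'rV[R]_3) : R := meval (fun i => x 0 i) n.

(* Points and fields are row vectors, so that the usual (column) Jacobian
   matrix is the transpose of the library's ['J f x]:
   the derivative of f at x in the direction v is [v *m 'J f x]. *)
Definition element_map (f : 'rV[R]_3 -> 'rV[R]_3) : Prop :=
  [/\ forall x, Omega x -> differentiable f x,
      {within Omega, continuous (jacobian f)},
      forall x, Omega x -> \det (jacobian f x) != 0 &
      forall x y, Omega x -> Omega y -> f x = f y -> x = y].

(* A conforming mesh of the union of the X e (Omega). Two distinct elements
   meet along a common vertex, edge or face (or not at all, s being empty), on
   which both element maps agree for the correspondence sg of the local
   vertices; sg is increasing since the local vertex orders agree. When the
   maps are affine, their agreement on s just says that sg identifies the
   vertices. *)
Definition conforming_mesh (E : finType) (X : E -> 'rV[R]_3 -> 'rV[R]_3) :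
    Prop :=
  (forall e, element_map (X e)) /\
  (forall e e', e != e' ->
    exists (s : {set 'I_4}) (sg : 'I_4 -> 'I_4),
      [/\ (#|s| <= 3)%N,
          {in s &, forall i j : 'I_4, (i < j)%N -> (sg i < sg j)%N},
          X e @` Omega `&` X e' @` Omega = X e @` hull s &
          forall l, weights s l ->
            X e (\sum_(i < 4) l i *: vertex i) =
            X e' (\sum_(i < 4) l i *: vertex (sg i))]).

(* s in the element e and s' in the element e' are the same polytope of the
   mesh. *)
Definition same_polytope (E : finType) (X : E -> 'rV[R]_3 -> 'rV[R]_3)
    (e : E) (s : {set 'I_4}) (e' : E) (s' : {set 'I_4}) : Prop :=
  X e @` hull s = X e' @` hull s'.

(* The family U s m, m < nbase p s, lists the base functions of the polytope s;
   on a mesh, functions of shared polytopes correspond to each other when they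
   have the same m. A function in the span of the assembled base functions is
   given by local coefficients that are equal on identified functions. *)
Definition h1_comb (p : nat) (U : {set 'I_4} -> nat -> poly3 R)
    (c : {set 'I_4} -> nat -> R) : poly3 R :=
  \sum_(s : {set 'I_4}) \sum_(m < nbase p s) c s m *: U s m.

Definition h1_compatible (E : finType) (X : E -> 'rV[R]_3 -> 'rV[R]_3)
    (c : E -> {set 'I_4} -> nat -> R) : Prop :=
  forall e e' (s s' : {set 'I_4}) m,
    same_polytope X e s e' s' -> c e s m = c e' s' m.

(* The condition [~~ (s \subset t)] covers the prescribed zeros: the other
   polytopes of the same dimension, and the edges and faces that do not
   contain s. For an edge or face s it also lists polytopes of lower dimension,
   where vanishing follows by restriction. *)
Record h1_conforming_basis (p : nat) (U : {set 'I_4} -> nat -> poly3 R) :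
    Prop := {
  h1_degree : forall s m, (m < nbase p s)%N ->
    (mpoly.msize (U s m) <= p.+1)%N; (* msize: total degree plus one *)
  h1_free : forall c, h1_comb p U c = 0 ->
    forall s m, (m < nbase p s)%N -> c s m = 0;
  h1_vanish : forall (s t : {set 'I_4}) m x, (m < nbase p s)%N ->
    ~~ (s \subset t) -> hull t x -> eval (U s m) x = 0;
  h1_continuous : forall (E : finType) (X : E -> 'rV[R]_3 -> 'rV[R]_3),
    conforming_mesh X ->
    forall c, h1_compatible X c ->
    forall e e' x x', Omega x -> Omega x' -> X e x = X e' x' ->
    eval (h1_comb p U (c e)) x = eval (h1_comb p U (c e')) x'
}.

(* n is normal at the image of x to the image of the face f under a map whose
   derivative at x is J; with J = 1%:M, n is normal to f itself. *)
Definition face_normal (J : 'M[R]_3) (f : {set 'I_4}) (n : 'rV[R]_3) : Prop :=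
  forall i j, i \in f -> j \in f -> dot n ((vertex j - vertex i) *m J) = 0.

(* The products of base functions of s with template s t are associated with
   the face f. The remaining products are the ones of the cell. *)
Definition on_face (f s : {set 'I_4}) (t : 'I_3) : Prop :=
  [/\ #|f| = 3%N, s \subset f &
      exists2 n, face_normal 1%:M f n & dot n (template s t) != 0].

Definition hdiv_comb (p : nat) (U : {set 'I_4} -> nat -> poly3 R)
    (d : {set 'I_4} -> nat -> 'I_3 -> R) : 'rV[poly3 R]_3 :=
  \sum_(s : {set 'I_4}) \sum_(m < nbase p s) \sum_(t < 3)
     (d s m t *: U s m) *: map_mx (@mpolyC 3 R) (template s t).

(* The products are identified when they are associated with the same face of
   the mesh and their scalar factors are identified. Cell products are never
   identified: each assembled one lives on a single element. *)
Definition hdiv_compatible (E : finType) (X : E -> 'rV[R]_3 -> 'rV[R]_3)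
    (d : E -> {set 'I_4} -> nat -> 'I_3 -> R) : Prop :=
  forall e e' (f f' s s' : {set 'I_4}) m t t',
    same_polytope X e f e' f' -> same_polytope X e s e' s' ->
    on_face f s t -> on_face f' s' t' ->
    d e s m t = d e' s' m t'.

(* The contravariant Piola transform of phi along f, at the point f x. *)
Definition piola (f : 'rV[R]_3 -> 'rV[R]_3) (phi : 'rV[poly3 R]_3)
    (x : 'rV[R]_3) : 'rV[R]_3 :=
  (\det (jacobian f x))^-1 *:
  (map_mx (fun n => eval n x) phi *m jacobian f x).

(* Piecewise fields: u e is the restriction of the field to the element e (on
   an interface, its trace from e). *)
Definition hdiv_space (p : nat) (U : {set 'I_4} -> nat -> poly3 R)
    (E : finType) (X : E -> 'rV[R]_3 -> 'rV[R]_3) :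
    set (E -> 'rV[R]_3 -> 'rV[R]_3) :=
  [set u | exists2 d, hdiv_compatible X d &
     forall e x, Omega x -> u e (X e x) = piola (X e) (hdiv_comb p U (d e)) x].

Definition no_normal_jump (E : finType) (X : E -> 'rV[R]_3 -> 'rV[R]_3) :
    set (E -> 'rV[R]_3 -> 'rV[R]_3) :=
  [set u | forall e e' (f f' : {set 'I_4}),
     e != e' -> #|f| = 3%N -> same_polytope X e f e' f' ->
     forall x n, hull f x -> face_normal (jacobian (X e) x) f n ->
     dot n (u e (X e x)) = dot n (u e' (X e x))].

End Tetrahedron.

(* Main.v *)
Require Import Defs.
From mathcomp Require Import all_boot all_order all_algebra.
From mathcomp Require Import all_classical all_reals all_analysis.
From mathcomp Require Import -(notations) mpoly.
From mathcomp Require Import ring lra zify.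
Local Open Scope classical_set_scope.
Local Open Scope ring_scope.

(* Let [nu q] be the cross product of two edge vectors of a face, taken in the
   order of the vertices. For every polytope s of the face, exactly one vector
   of the template T_s has a nonzero product with [nu q], and this product is 1,
   on every face. On the face, the products associated with it thus have a
   trace along [nu q] that is a combination of the base functions of U^p, with
   the same coefficients from both sides of an interface. The two elements of
   the interface form a mesh of their own, on which H^1-conformity makes these
   combinations agree. The element maps agree on the interface, hence so do
   their tangential derivatives, and the Piola transform carries agreeing
   traces along [nu q] to agreeing normal traces. *)

Set Implicit Arguments.
Unset Strict Implicit.
Unset Printing Implicit Defensive.

Import Order.TTheory GRing.Theory Num.Theory.
Import numFieldNormedType.Exports.

Lemma sum_ord3 (V : nmodType) (F : 'I_3 -> V) :
  \sum_(i < 3) F i = F 0 + F 1 + F 2%:R.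
Proof.
rewrite !big_ord_recl big_ord0 addr0 addrA.
by congr (_ + F _ + F _); apply: val_inj.
Qed.

Lemma ord3_ind (P : 'I_3 -> Prop) : P 0 -> P 1 -> P 2%:R -> forall i, P i.
Proof.
move=> P0 P1 P2 [[|[|[|//]]] i].
- by rewrite (_ : Ordinal i = 0) //; apply: val_inj.
- by rewrite (_ : Ordinal i = 1) //; apply: val_inj.
- by rewrite (_ : Ordinal i = 2%:R) //; apply: val_inj.
Qed.

(** * Cross products and normal components *)

Section CrossProduct.
Variable R : realType.
Implicit Types (a b c n x y z : 'rV[R]_3) (J : 'M[R]_3).

Definition cross a b : 'rV[R]_3 := \row_k
  nth 0 [:: a 0 1 * b 0 2%:R - a 0 2%:R * b 0 1;
            a 0 2%:R * b 0 0 - a 0 0 * b 0 2%:R;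
            a 0 0 * b 0 1 - a 0 1 * b 0 0] k.

Lemma dotE x y : dot x y = x 0 0 * y 0 0 + x 0 1 * y 0 1 + x 0 2%:R * y 0 2%:R.
Proof. exact: sum_ord3. Qed.

Lemma dotDr n x y : dot n (x + y) = dot n x + dot n y.
Proof. by rewrite !dotE !mxE; ring. Qed.

Lemma dotZr n k x : dot n (k *: x) = k * dot n x.
Proof. by rewrite !dotE !mxE; ring. Qed.

Lemma dotBr n x y : dot n (x - y) = dot n x - dot n y.
Proof. by rewrite !dotE !mxE; ring. Qed.

Lemma dot_sumr n (I : finType) (F : I -> 'rV[R]_3) :
  dot n (\sum_i F i) = \sum_i dot n (F i).
Proof.
apply: (big_morph (dot n)); first exact: dotDr.
by rewrite dotE !mxE; ring.
Qed.

Lemma det_mx33 (g : nat -> nat -> R) :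
  \det (\matrix_(i < 3, j < 3) g i j) =
    g 0 0 * (g 1 1 * g 2 2 - g 1 2 * g 2 1) -
    g 0 1 * (g 1 0 * g 2 2 - g 1 2 * g 2 0) +
    g 0 2 * (g 1 0 * g 2 1 - g 1 1 * g 2 0).
Proof.
rewrite (expand_det_row _ 0) !big_ord_recl big_ord0 /cofactor.
rewrite !(expand_det_row _ 0) !big_ord_recl !big_ord0 /cofactor.
by rewrite !det_mx11 !mxE /= /bump /=; ring.
Qed.

Lemma dot_crossE a b c :
  dot (cross a b) c = \det (\matrix_(i < 3, j < 3) nth 0 [:: a; b; c] i 0 j).
Proof.
pose g i j : R := nth 0 [:: a; b; c] i 0 (inord j).
have -> : (\matrix_(i < 3, j < 3) nth 0 [:: a; b; c] i 0 j) =
          \matrix_(i < 3, j < 3) g i j.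
  by apply/matrixP => i j; rewrite !mxE /g inord_val.
rewrite det_mx33 /g /= dotE !mxE /=.
have i0 : inord 0 = 0 :> 'I_3 by apply: val_inj; rewrite /= inordK.
have i1 : inord 1 = 1 :> 'I_3 by apply: val_inj; rewrite /= inordK.
have i2 : inord 2 = 2%:R :> 'I_3 by apply: val_inj; rewrite /= inordK.
by rewrite i0 i1 i2; ring.
Qed.

(** The triple product is the determinant with rows [a], [b], [c], and applying [J] to each row
    multiplies that matrix by [J]. *)
Lemma dot_crossM a b c J :
  dot (cross (a *m J) (b *m J)) (c *m J) = dot (cross a b) c * \det J.
Proof.
rewrite !dot_crossE -det_mulmx; congr (\det _); apply/matrixP => i j.
rewrite !mxE; case: i => -[|[|[|//]]] ? /=; rewrite mxE;
  by apply: eq_bigr => k _; rewrite mxE.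
Qed.

Lemma dot_cross_normal a b n x y : dot n a = 0 -> dot n b = 0 ->
  dot (cross a b) x * dot n y = dot (cross a b) y * dot n x.
Proof.
move=> na nb; apply/eqP; rewrite -subr_eq0; apply/eqP.
(* Cramer's linear relation between the four vectors [a], [b], [x], [y] of a three-dimensional
   space, paired with [n]. *)
transitivity (dot (cross b x) y * dot n a - dot (cross a x) y * dot n b).
  by rewrite !dotE !mxE /=; ring.
by rewrite na nb; ring.
Qed.

(* n is a multiple of the cross product of a J and b J, so that the normal
   component of the transform of z is the same multiple of the one of z along
   [cross a b]. The vector w witnesses that a and b are independent. *)
Lemma normal_piola a b a' b' n z z' w J J' :
  \det J != 0 -> \det J' != 0 ->
  a *m J = a' *m J' -> b *m J = b' *m J' ->
  dot n (a *m J) = 0 -> dot n (b *m J) = 0 ->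
  dot (cross a b) w = 1 -> dot (cross a b) z = dot (cross a' b') z' ->
  dot n ((\det J)^-1 *: (z *m J)) = dot n ((\det J')^-1 *: (z' *m J')).
Proof.
move=> dJ dJ' aJ bJ na nb w1 zz'.
have := dot_cross_normal (z *m J) (w *m J) na nb.
rewrite !dot_crossM w1 mul1r => nz.
have := dot_cross_normal (z' *m J') (w *m J) na nb.
(* Only the cross product paired with [z'] moves to the primed side; the one paired with [w *m J]
   stays, so [w1] applies and [nz], [nz'] share the factor [dot n (w *m J)]. *)
rewrite {1}aJ {1}bJ !dot_crossM w1 mul1r -zz' => nz'.
by rewrite !dotZr; apply: (mulfI dJ); rewrite mulVKf // mulrCA -nz';
  apply: (mulfI dJ); rewrite -nz; field.
Qed.

End CrossProduct.

(** * Face normals and templates *)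

Section Tetrahedron.
Variable R : realType.
Implicit Types (x y : 'rV[R]_3) (s f : {set 'I_4}).

(* The face opposite to the vertex q, whose vertices are the [lift q r] in
   increasing order. *)
Definition face (q : 'I_4) : {set 'I_4} := ~: [set q].

Definition edge (q : 'I_4) (r : 'I_3) : 'rV[R]_3 :=
  vertex R (lift q r) - vertex R (lift q 0).

Definition nu (q : 'I_4) : 'rV[R]_3 := cross (edge q 1) (edge q 2%:R).

(** Lets [templates s] compute once the four memberships are known. *)
Lemma enum_set4 s :
  enum s = [seq i <- [:: @Ordinal 4 0 isT; @Ordinal 4 1 isT;
                         @Ordinal 4 2 isT; @Ordinal 4 3 isT] | i \in s].
Proof.
rewrite (_ : [:: _; _; _; _] = enum 'I_4); first by rewrite enumT.
by apply: (inj_map val_inj); rewrite val_enum_ord.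
Qed.

Lemma vertexE i k : vertex R i 0 k = (i + k == 3)%N%:R.
Proof.
by case: i => -[|[|[|[|//]]]] i; case: k => -[|[|[|//]]] k; rewrite !mxE.
Qed.

(** The orientation follows the vertex order and not the boundary: these vectors point inward and
    outward alternately. *)
Lemma nuE q : nu q = nth 0 [:: - (e1 R + e2 R + e3 R); - e3 R; e2 R; - e1 R] q.
Proof.
apply/rowP; case=> -[|[|[|//]]] k; rewrite !mxE !vertexE.
all: by case: q => -[|[|[|[|//]]]] q; rewrite !mxE /= ?mxE /=; ring.
Qed.

Lemma mem_set4 i s : i \in s ->
  [|| @Ordinal 4 0 isT \in s, @Ordinal 4 1 isT \in s,
      @Ordinal 4 2 isT \in s | @Ordinal 4 3 isT \in s].
Proof.
case: i => -[|[|[|[|//]]]] i; rewrite (bool_irrelevance i isT) => ->;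
  by rewrite ?orbT.
Qed.

Lemma sub_face q s : (s \subset face q) = (q \notin s).
Proof. by rewrite /face finset.subsetC finset.sub1set finset.in_setC. Qed.

(** A finite check over the 28 pairs of a face and a nonempty subset of its vertices; the three
    values of [t0] are tried in turn. *)
Lemma nu_template q s i : i \in s -> s \subset face q ->
  exists t0, forall t, dot (nu q) (template R s t) = (t == t0)%:R.
Proof.
rewrite sub_face => /mem_set4 si sq.
rewrite nuE /template /templates enum_set4 /=.
have {sq} : ~~ nth false [:: @Ordinal 4 0 isT \in s; @Ordinal 4 1 isT \in s;
     @Ordinal 4 2 isT \in s; @Ordinal 4 3 isT \in s] q.
  by case: q sq => -[|[|[|[|//]]]] q; rewrite (bool_irrelevance q isT).
move: si; case: (@Ordinal 4 0 isT \in s); case: (@Ordinal 4 1 isT \in s);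
case: (@Ordinal 4 2 isT \in s); case: (@Ordinal 4 3 isT \in s) => //= _;
  case: q => -[|[|[|[|//]]]] q //= _.
all: by [exists 0; elim/ord3_ind; rewrite dotE !mxE /= ?mxE /=; ring
        |exists 1; elim/ord3_ind; rewrite dotE !mxE /= ?mxE /=; ring
        |exists 2%:R; elim/ord3_ind; rewrite dotE !mxE /= ?mxE /=; ring].
Qed.

(** Each of the 15 templates is a basis of the space, so the three coordinate equations force [d] to
    vanish. *)
Lemma template_free s i (d : 'I_3 -> R) : i \in s ->
  \sum_t d t *: template R s t = 0 -> forall t, d t = 0.
Proof.
move=> /mem_set4 si /rowP dT.
have := (dT 0, dT 1, dT 2%:R) => {dT}.
rewrite !sum_ord3 /template /templates enum_set4 /=.
move: si; case: (@Ordinal 4 0 isT \in s); case: (@Ordinal 4 1 isT \in s);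
case: (@Ordinal 4 2 isT \in s); case: (@Ordinal 4 3 isT \in s) => //= _.
all: by rewrite !mxE /= ?mxE /= => -[[? ?] ?]; elim/ord3_ind; lra.
Qed.

(** * Barycentric coordinates, hulls and faces *)

Definition bary (l : 'I_4 -> R) : 'rV[R]_3 := \sum_(i < 4) l i *: vertex R i.

(* For i > 0, [vertex i] is the basis vector of index 3 - i, hence [rev_ord]. *)
Lemma bary_coord (l : 'I_4 -> R) (k : 'I_3) :
  bary l 0 (rev_ord k) = l (lift 0 k).
Proof.
rewrite /bary summxE (bigD1 (lift 0 k)) //= big1 ?addr0.
  rewrite mxE vertexE lift0 /= (_ : (_ == _)%N = true) ?mulr1 //.
  by rewrite subnKC // ltn_ord.
move=> i ik; rewrite mxE vertexE (_ : (_ == _) = false) ?mulr0 //=.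
apply/negP => /eqP ik3; case/eqP: ik; apply: val_inj => /=; rewrite /bump /=.
by have := ltn_ord k; lia.
Qed.

(** The Cartesian coordinates are the weights of all vertices but the origin, whose weight then
    follows from the total. *)
Lemma bary_inj (l l' : 'I_4 -> R) :
  \sum_i l i = \sum_i l' i -> bary l = bary l' -> l =1 l'.
Proof.
move=> ll' bl.
have eql k : l (lift 0 k) = l' (lift 0 k) by rewrite -!bary_coord bl.
move=> i; case: (unliftP 0 i) => [k|] ->; first exact: eql.
move: ll'; rewrite !(big_ord_recl 3).
rewrite (eq_bigr (fun k => l' (lift ord0 k))) => [/addIr //|k _].
exact: eql.
Qed.

Lemma hull_Omega s : hull s `<=` Omega (R := R).
Proof.
move=> _ [l [l0 _ l1] <-]; split=> [k|].
  by rewrite -[k]rev_ordK bary_coord.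
rewrite (reindex_inj rev_ord_inj) /=.
under eq_bigr do rewrite bary_coord.
by move: l1; rewrite big_ord_recl => <-; rewrite lerDr.
Qed.

Lemma vertex_bary i : vertex R i = bary (fun j => (j == i)%:R).
Proof.
rewrite /bary (bigD1 i) //= eqxx scale1r big1 ?addr0 // => j /negPf ->.
by rewrite scale0r.
Qed.

Lemma sum_delta1 (n : nat) (i : 'I_n) : \sum_(j < n) (j == i)%:R = 1 :> R.
Proof.
by rewrite (bigD1 i) //= eqxx big1 ?addr0 // => j /negPf ->.
Qed.

Lemma hull_vertex i s : hull s (vertex R i) <-> i \in s.
Proof.
split=> [[l [_ ls l1]]|si].
  rewrite vertex_bary => /(bary_inj _) => /(_ _ i); rewrite l1 sum_delta1 eqxx.
  move=> /(_ erefl) li; apply: contraT => /ls; rewrite li => /eqP.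
  by rewrite oner_eq0.
exists (fun j => (j == i)%:R); last by rewrite vertex_bary.
split=> [j|j sj|]; first by case: eqP.
  by case: eqP => // ji; rewrite -ji (negPf sj) in si.
exact: sum_delta1.
Qed.

Lemma hull_subset s t : hull (R := R) s `<=` hull t <-> s \subset t.
Proof.
split=> [st|/fintype.subsetP st].
  by apply/fintype.subsetP => i /hull_vertex/st/hull_vertex.
move=> _ [l [l0 ls l1] <-]; exists l => //; split=> // i.
by move=> it; apply: ls; apply: contra it => /st.
Qed.

(** Weights are indexed by the rank of a vertex in the face, so that the same [l] names
    corresponding points of two faces. *)
Definition face_point (q : 'I_4) (l : 'I_3 -> R) : 'rV[R]_3 :=
  \sum_(r < 3) l r *: vertex R (lift q r).

Definition weights3 (l : 'I_3 -> R) : Prop :=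
  (forall r, 0 <= l r) /\ \sum_r l r = 1.

Lemma weights_face q (l : 'I_3 -> R) : weights3 l ->
  weights (face q) (fun i => oapp l 0 (unlift q i)).
Proof.
move=> [l0 l1]; split=> [i|i|]; first by case: unliftP => [r _|_] /=.
  by rewrite finset.in_setC finset.in_set1 negbK => /eqP ->; rewrite unlift_none.
rewrite (bigD1_ord q) //= unlift_none add0r -l1.
by apply: eq_bigr => r _; rewrite liftK.
Qed.

Lemma sum_face q (l : 'I_3 -> R) (v : 'I_4 -> 'rV[R]_3) :
  \sum_(i < 4) oapp l 0 (unlift q i) *: v i = \sum_(r < 3) l r *: v (lift q r).
Proof.
rewrite (bigD1_ord q) //= unlift_none scale0r add0r.
by apply: eq_bigr => r _; rewrite liftK.
Qed.

Lemma hull_face q (x : 'rV[R]_3) : hull (face q) x <->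
  exists2 l, weights3 l & x = face_point q l.
Proof.
split=> [[l [l0 lq l1] <-]|[l lw ->]].
  have {}lq : l q = 0 by apply: lq; rewrite finset.in_setC finset.in_set1 eqxx.
  exists (fun r => l (lift q r)).
    by split=> //; rewrite -l1 [RHS](bigD1_ord q) //= lq add0r.
  by rewrite /face_point (bigD1_ord q) //= lq scale0r add0r.
exists (fun i => oapp l 0 (unlift q i)); first exact: weights_face.
exact: sum_face.
Qed.

Lemma card3_face f : #|f| = 3%N -> exists q, f = face q.
Proof.
move=> f3; have /cards1P[q fq] : #|~: f| == 1%N.
  by rewrite cardsCs finset.setCK f3 card_ord.
by exists q; rewrite /face -fq finset.setCK.
Qed.

Lemma card_face q : #|face q| = 3%N.
Proof. by rewrite /face cardsC1 card_ord. Qed.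

Lemma lift_face q r : lift q r \in face q.
Proof. by rewrite finset.in_setC finset.in_set1 eq_sym neq_lift. Qed.

(** Both faces have three vertices, and the only increasing map between them preserves ranks. *)
Lemma increasing_lift q q' (sg : 'I_4 -> 'I_4) :
  {in face q &, forall i j : 'I_4, (i < j)%N -> (sg i < sg j)%N} ->
  (forall i, i \in face q -> sg i \in face q') ->
  forall r, sg (lift q r) = lift q' r.
Proof.
move=> sgi sgq.
have lt (r r' : 'I_3) : (r < r')%N -> (sg (lift q r) < sg (lift q r'))%N.
  by move=> rr'; apply: sgi; rewrite ?lift_face //= /bump; lia.
have ne r : nat_of_ord (sg (lift q r)) != q'.
  have := sgq _ (lift_face q r).
  by rewrite finset.in_setC finset.in_set1 -val_eqE.
move: (lt 0 1 isT) (lt 1 2%:R isT) (ltn_ord (sg (lift q 2%:R))).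
move: (ne 0) (ne 1) (ne 2%:R) => n0 n1 n2 lt01 lt12 lt24.
elim/ord3_ind; apply: val_inj; rewrite /= /bump /=;
  move: n0 n1 n2 lt01 lt12 lt24 (ltn_ord q');
  move: (nat_of_ord (sg (lift q 0))) (nat_of_ord (sg (lift q 1)))
    (nat_of_ord (sg (lift q 2%:R))) => a b c; lia.
Qed.

(** * Shared polytopes of a conforming mesh *)

Section Mesh.
Variables (E : finType) (X : E -> 'rV[R]_3 -> 'rV[R]_3).
Hypothesis XP : conforming_mesh X.

Lemma mesh_inj e x y : Omega x -> Omega y -> X e x = X e y -> x = y.
Proof. by case: XP => /(_ e)[_ _ _ inj] _; exact: inj. Qed.

Lemma mesh_hull_subset e s t :
  X e @` hull s `<=` X e @` hull t -> s \subset t.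
Proof.
move=> st; apply/hull_subset => x sx.
have /st[y ty /mesh_inj <- //] : (X e @` hull s) (X e x) by exists x.
  exact: hull_Omega ty.
exact: hull_Omega sx.
Qed.

Lemma mesh_vertex e s i : (X e @` hull s) (X e (vertex R i)) -> i \in s.
Proof.
move=> [x sx /mesh_inj xi]; apply/hull_vertex; rewrite -xi //.
  exact: hull_Omega sx.
by apply: (@hull_Omega [set i]%SET); apply/hull_vertex; rewrite finset.in_set1.
Qed.

Lemma shared_vertices e e' f f' s :
  X e @` @Omega R `&` X e' @` @Omega R = X e @` hull s ->
  same_polytope X e f e' f' -> f \subset s.
Proof.
move=> sE ff'; apply: (@mesh_hull_subset e) => y fy; rewrite -sE; split.
  exact: image_subset (@hull_Omega _) _ fy.
by rewrite ff' in fy; exact: image_subset (@hull_Omega _) _ fy.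
Qed.

Lemma mesh_glue e e' f f' : e != e' -> #|f| = 3%N ->
  same_polytope X e f e' f' ->
  exists sg : 'I_4 -> 'I_4,
    [/\ {in f &, forall i j : 'I_4, (i < j)%N -> (sg i < sg j)%N},
        forall i, i \in f -> sg i \in f' &
        forall l, weights f l -> X e (bary l) =
          X e' (\sum_(i < 4) l i *: vertex R (sg i))].
Proof.
move=> ee' f3 ff'; have [_ /(_ e e' ee') [s [sg [s3 sgi sE sX]]]] := XP.
(* The shared face lies in the interface [s], which has at most three vertices, hence fills it. *)
have fs : f = s.
  by apply/eqP; rewrite eqEcard f3 s3 andbT; exact: shared_vertices sE ff'.
rewrite -{}fs in sgi sX; exists sg; split=> // i fi.
(* With all the weight at [i], the gluing identifies [vertex i] in [e] with [vertex (sg i)] in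
   [e']. *)
apply: (@mesh_vertex e'); rewrite -ff'; exists (vertex R i).
  exact/hull_vertex.
rewrite (vertex_bary i) /bary sX; last first.
  split=> [j|j jf|]; first by case: eqP.
    by case: eqP => // ji; rewrite -ji (negPf jf) in fi.
  exact: sum_delta1.
congr (X e' _); rewrite (bigD1 i) //= eqxx scale1r big1 ?addr0 // => j.
by move=> /negPf ->; rewrite scale0r.
Qed.

(** Seen from [e'], the interface bounds [f'] by three vertices; the injective gluing of [f] into
    [f'] gives the other inequality. *)
Lemma mesh_face_card e e' f f' : e != e' -> #|f| = 3%N ->
  same_polytope X e f e' f' -> #|f'| = 3%N.
Proof.
move=> ee' f3 ff'; have [sg [sgi sgf _]] := mesh_glue ee' f3 ff'.
apply/eqP; rewrite eqn_leq; apply/andP; split.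
  move: ee'; rewrite eq_sym; have [_ /[apply]] := XP.
  move=> [s [_ [s3 _ sE _]]]; apply: leq_trans s3; apply: subset_leq_card.
  exact: shared_vertices sE (esym ff').
have sg3 : #|sg @: f| = 3%N; last first.
  rewrite -[leqLHS]sg3; apply: subset_leq_card.
  by apply/fintype.subsetP => _ /imsetP[i fi ->]; exact: sgf.
rewrite card_in_imset // => i j fi fj sij; apply: val_inj.
case: (ltngtP i j) => // ij.
  by have := sgi _ _ fi fj ij; rewrite sij ltnn.
by have := sgi _ _ fj fi ij; rewrite sij ltnn.
Qed.

Lemma mesh_face e e' q q' : e != e' ->
  same_polytope X e (face q) e' (face q') ->
  forall l, weights3 l -> X e (face_point q l) = X e' (face_point q' l).
Proof.
move=> ee' qq' l lw; have [sg [sgi sgq sX]] := mesh_glue ee' (card_face q) qq'.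
have := sX _ (weights_face q lw).
rewrite /bary !sum_face => ->; congr (X e' _); apply: eq_bigr => r _.
by rewrite (increasing_lift sgi sgq).
Qed.

End Mesh.

(** * Tangential derivatives on an interface *)

Lemma derivative_eq (f g : 'rV[R]_3 -> 'rV[R]_3) x y v w :
  differentiable f x -> differentiable g y ->
  (forall h, 0 <= h -> h <= 1 -> f (x + h *: v) = g (y + h *: w)) ->
  v *m jacobian f x = w *m jacobian g y.
Proof.
move=> df dg fg; rewrite -(deriveEjacobian v df) -(deriveEjacobian w dg).
(* The maps are compared only for [h >= 0], as at a boundary point of a face; by differentiability,
   the limit from the right already determines the derivative. *)
have cvf := cvg_dnbhs_at_right (@diff_derivable _ _ _ f x v df).
have cvg := cvg_dnbhs_at_right (@diff_derivable _ _ _ g y w dg).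
apply: cvg_unique cvf _; first exact: norm_hausdorff.
apply: cvg_trans cvg; apply: near_eq_cvg.
near=> h.
have h0 : 0 < h by near: h; exact: nbhs_right_gt.
have h1 : h <= 1 by near: h; exact: nbhs_right_le.
have := fg 0 (lexx 0) ler01; rewrite !scale0r !addr0 => xy.
by rewrite /= ![h *: _ + _]addrC fg ?ltW // xy.
Unshelve. all: by end_near.
Qed.

(** Moving from any point of a face towards one of its vertices stays in the face, so the
    derivatives in these directions agree; an edge is a difference of two such directions. *)
Lemma face_jacobian (f g : 'rV[R]_3 -> 'rV[R]_3) q q' l r :
  weights3 l ->
  differentiable f (face_point q l) -> differentiable g (face_point q' l) ->
  (forall m, weights3 m -> f (face_point q m) = g (face_point q' m)) ->
  edge q r *m jacobian f (face_point q l) =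
  edge q' r *m jacobian g (face_point q' l).
Proof.
move=> lw df dg fg.
have dE i : (vertex R (lift q i) - face_point q l) *m
      jacobian f (face_point q l) =
    (vertex R (lift q' i) - face_point q' l) *m
      jacobian g (face_point q' l).
  apply: derivative_eq => // h h0 h1.
  have pE p : face_point p l + h *: (vertex R (lift p i) - face_point p l) =
      face_point p (fun k => (1 - h) * l k + h * (k == i)%:R).
    have -> : vertex R (lift p i) = \sum_k (k == i)%:R *: vertex R (lift p k).
      rewrite (bigD1 i) //= eqxx scale1r big1 ?addr0 // => k /negPf ->.
      by rewrite scale0r.
    under [RHS]eq_bigr do rewrite scalerDl -!scalerA.
    rewrite big_split /= -!scaler_sumr -/(face_point p l).
    by rewrite scalerBr scalerBl scale1r addrCA addrC.
  rewrite !pE; apply: fg; case: lw => l0 l1; split=> [k|].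
    by apply: addr_ge0; apply: mulr_ge0; rewrite ?subr_ge0 //; case: eqP.
  by rewrite big_split /= -!mulr_sumr l1 sum_delta1 !mulr1 subrK.
have edgeE p : edge p r = (vertex R (lift p r) - face_point p l) -
    (vertex R (lift p 0) - face_point p l) by rewrite opprB addrA subrK.
by rewrite !edgeE [LHS]mulmxBl [RHS]mulmxBl !dE.
Qed.

(** * Traces of the products along [nu] *)

Lemma submesh (E E' : finType) (X : E -> 'rV[R]_3 -> 'rV[R]_3) (g : E' -> E) :
  injective g -> conforming_mesh X -> conforming_mesh (X \o g).
Proof.
move=> gI [Xe XX]; split=> [e|e e' ee']; first exact: Xe.
by apply: XX; rewrite (inj_eq gI).
Qed.

Lemma nu_normal q : face_normal 1%:M (face q) (nu q).
Proof.
have nuv r : dot (nu q) (edge q r) = 0.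
  elim/ord3_ind: r.
  - by rewrite /edge subrr dotE !mxE !mulr0 !addr0.
  - by rewrite /nu dotE !mxE /=; ring.
  - by rewrite /nu dotE !mxE /=; ring.
move=> i j; rewrite !finset.in_setC !finset.in_set1 ![_ == q]eq_sym.
move=> /unlift_some[r -> _] /unlift_some[r' -> _]; rewrite mulmx1.
have -> : vertex R (lift q r') - vertex R (lift q r) = edge q r' - edge q r.
  by rewrite opprB addrA subrK.
by rewrite dotBr !nuv subrr.
Qed.

Lemma nu_on_face q s i : i \in s -> s \subset face q ->
  exists2 t0, on_face R (face q) s t0 &
    forall t, dot (nu q) (template R s t) = (t == t0)%:R.
Proof.
move=> si sq; have [t0 tt0] := nu_template si sq.
exists t0 => //; split=> //; first exact: card_face.
by exists (nu q); [exact: nu_normal|rewrite tt0 eqxx oner_eq0].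
Qed.

Lemma hull_set0 : hull (R := R) finset.set0 = set0.
Proof.
apply/seteqP; split=> // _ [l [_ l0 l1] _] /=.
move: l1; rewrite big1 => [/esym/eqP|i _]; first by rewrite oner_eq0.
by apply: l0; rewrite finset.inE.
Qed.

Lemma template_set0 t : template R finset.set0 t = 0.
Proof. by rewrite /template /templates enum_set0 nth_nil. Qed.

Section Traces.
Variables (p : nat) (U : {set 'I_4} -> nat -> poly3 R).

(** Coefficients in U^p of the trace on the face; polytopes outside the face get 0, their base
    functions vanishing there. *)
Definition face_coef (q : 'I_4) (d : {set 'I_4} -> nat -> 'I_3 -> R)
    (s : {set 'I_4}) (m : nat) : R :=
  if s \subset face q then \sum_t d s m t * dot (nu q) (template R s t) else 0.

Lemma eval_hdiv_comb d x :
  map_mx (fun n => Defs.eval n x) (hdiv_comb p U d) =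
  \sum_s \sum_(m < nbase p s)
    Defs.eval (U s m) x *: \sum_(t < 3) d s m t *: template R s t.
Proof.
apply/rowP => k; rewrite !mxE /hdiv_comb !summxE /Defs.eval raddf_sum /=.
apply: eq_bigr => s _; rewrite !summxE raddf_sum; apply: eq_bigr => m _ /=.
rewrite mxE !summxE raddf_sum mulr_sumr; apply: eq_bigr => t _ /=.
by rewrite !mxE mevalM mevalZ mevalC; ring.
Qed.

Lemma face_trace q d x : h1_conforming_basis p U -> hull (face q) x ->
  dot (nu q) (map_mx (fun n => Defs.eval n x) (hdiv_comb p U d)) =
  Defs.eval (h1_comb p U (face_coef q d)) x.
Proof.
move=> hU qx; rewrite eval_hdiv_comb dot_sumr /h1_comb /Defs.eval raddf_sum /=.
apply: eq_bigr => s _; rewrite dot_sumr raddf_sum; apply: eq_bigr => m _ /=.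
rewrite dotZr mevalZ dot_sumr /face_coef; case: ifPn => sq.
  by rewrite mulrC; congr (_ * _); apply: eq_bigr => t _; rewrite dotZr.
have := h1_vanish hU (ltn_ord m) sq qx; rewrite /Defs.eval => ->.
by rewrite !mul0r.
Qed.

Lemma hdiv_free d : h1_conforming_basis p U -> hdiv_comb p U d = 0 ->
  forall s m t, (m < nbase p s)%N -> d s m t = 0.
Proof.
move=> hU d0 s m t ms.
have [s0|[i si]] := finset.set_0Vmem s.
  by move: ms; rewrite s0 /nbase cards0.
apply: (template_free si (d := d s m)).
apply/rowP => k; rewrite [RHS]mxE.
(* Each Cartesian component of the combination is a combination of U^p, whose freeness kills every
   component of the template sums. *)
apply: (h1_free hU (c := fun s m => (\sum_t d s m t *: template R s t) 0 k)) ms.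
have /rowP/(_ k) := d0; rewrite [X in _ = X -> _]mxE => <-.
rewrite /hdiv_comb /h1_comb !summxE; apply: eq_bigr => s' _.
rewrite !summxE; apply: eq_bigr => m' _.
rewrite !summxE scaler_suml; apply: eq_bigr => t' _.
by rewrite !mxE -!mul_mpolyC mpolyCM mulrAC -mulrA.
Qed.

(** Each sum over [t] collapses to the single product associated with the face, and
    [hdiv_compatible] equates these. Every element is assumed to contain the face: an element
    meeting it only in an edge gives no such identification. *)
Lemma face_coef_compatible (E : finType) (X : E -> 'rV[R]_3 -> 'rV[R]_3)
    (d : E -> {set 'I_4} -> nat -> 'I_3 -> R) (q : E -> 'I_4) :
  conforming_mesh X -> hdiv_compatible X d ->
  (forall e e', same_polytope X e (face (q e)) e' (face (q e'))) ->
  h1_compatible X (fun e => face_coef (q e) (d e)).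
Proof.
move=> XP dP qE.
have sub e e' s s' : same_polytope X e s e' s' ->
    s \subset face (q e) -> s' \subset face (q e').
  move=> ss' /hull_subset sq; apply: (mesh_hull_subset XP (e := e')).
  by rewrite -ss' -(qE e e'); exact: image_subset.
move=> e e' s s' m ss'; rewrite /face_coef.
have -> : (s' \subset face (q e')) = (s \subset face (q e)).
  by apply/idP/idP; apply: sub ss' || apply: sub (esym ss').
case: ifP => // sq; have s'q := sub _ _ _ _ ss' sq.
(* [h1_compatible] also ranges over the empty polytope; its template is zero, and so are both
   coefficients. *)
have [i_s|s0] := pselect (exists i, i \in s); last first.
  have {}s0 : s = finset.set0.
    by have [//|[i si]] := finset.set_0Vmem s; case: s0; exists i.
  have s'0 : s' = finset.set0.
    apply/eqP; rewrite -finset.subset0; apply: (mesh_hull_subset XP (e := e')).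
    by rewrite -ss' s0 hull_set0 image_set0.
  by rewrite s0 s'0 !big1 // => t _; rewrite template_set0 dotE !mxE; ring.
have [i' s'i'] : exists i', i' \in s'.
  apply: contrapT => s'0; case: i_s => i si.
  have s'E : s' = finset.set0.
    by have [//|[j sj]] := finset.set_0Vmem s'; case: s'0; exists j.
  have : (X e @` hull s) (X e (vertex R i)).
    by exists (vertex R i) => //; exact/hull_vertex.
  by rewrite ss' s'E hull_set0 image_set0.
case: i_s => i si.
have [t0 ft0 nut0] := nu_on_face si sq.
have [t1 ft1 nut1] := nu_on_face s'i' s'q.
have sumE (c : 'I_3 -> R) t2 : \sum_t c t * (t == t2)%:R = c t2.
  rewrite (bigD1 t2) //= eqxx mulr1 big1 ?addr0 // => t /negPf ->.
  by rewrite mulr0.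
under eq_bigr do rewrite nut0; under [RHS]eq_bigr do rewrite nut1.
by rewrite !sumE; apply: dP ss' ft0 ft1; exact: qE.
Qed.

Lemma hdiv_normal_trace (E : finType) (X : E -> 'rV[R]_3 -> 'rV[R]_3)
    (d : E -> {set 'I_4} -> nat -> 'I_3 -> R) e e' q q' l :
  h1_conforming_basis p U -> conforming_mesh X -> hdiv_compatible X d ->
  e != e' -> same_polytope X e (face q) e' (face q') -> weights3 l ->
  dot (nu q) (map_mx (fun n => Defs.eval n (face_point q l))
                     (hdiv_comb p U (d e))) =
  dot (nu q') (map_mx (fun n => Defs.eval n (face_point q' l))
                      (hdiv_comb p U (d e'))).
Proof.
move=> hU XP dP ee' qq' lw.
have hq : hull (face q) (face_point q l) by apply/hull_face; exists l.
have hq' : hull (face q') (face_point q' l) by apply/hull_face; exists l.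
rewrite !face_trace //.
(* The Booleans index the mesh formed by the two elements of the interface, both of which contain
   the face. *)
pose g b := if b then e else e'; pose qg (b : bool) := if b then q else q'.
have gI : injective g.
  by move=> [] [] //= /eqP; rewrite ?[e' == e]eq_sym (negPf ee').
have XgP := submesh gI XP.
apply: (h1_continuous hU XgP (c := fun b => face_coef (qg b) (d (g b)))
          _ (e := true) (e' := false)).
- apply: face_coef_compatible XgP _ _; first by move=> b b'; exact: dP.
  by move=> [] [] //; exact: esym qq'.
- exact: hull_Omega hq.
- exact: hull_Omega hq'.
- exact: mesh_face.
Qed.

End Traces.

(** * Normal continuity after the Piola transform *)

Lemma hdiv_no_normal_jump (p : nat) (U : {set 'I_4} -> nat -> poly3 R)
    (E : finType) (X : E -> 'rV[R]_3 -> 'rV[R]_3) :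
  h1_conforming_basis p U -> conforming_mesh X ->
  hdiv_space p U X `<=` no_normal_jump X.
Proof.
move=> hU XP u [d dP uE] e e' f f' ee' f3 ff' x n fx xn.
have [q fq] := card3_face f3; rewrite {}fq in f3 ff' fx xn.
have [q' fq'] := card3_face (mesh_face_card XP ee' f3 ff').
rewrite {}fq' in ff'; case/hull_face: fx => l lw xl; rewrite {}xl in xn *.
have Xl := mesh_face XP ee' ff'.
have Om p' : Omega (face_point p' l).
  by apply: (@hull_Omega (face p')); apply/hull_face; exists l.
have ue' : u e' (X e (face_point q l)) =
    piola (X e') (hdiv_comb p U (d e')) (face_point q' l).
  by rewrite (Xl l lw); apply: uE.
rewrite {}ue' (uE e _ (Om q)) /piola.
have [Xd _ Xdet _] : element_map (X e) by case: XP => XE _; exact: XE.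
have [Xd' _ Xdet' _] : element_map (X e') by case: XP => XE _; exact: XE.
have JE r := face_jacobian r lw (Xd _ (Om q)) (Xd' _ (Om q')) Xl.
have nE r : dot n (edge q r *m jacobian (X e) (face_point q l)) = 0.
  by apply: xn; exact: lift_face.
(* The witness [w] of independent edges is the vector of the face's own template whose product with
   [nu q] is 1. *)
have [t0 nut0] := nu_template (lift_face q 0) (fintype.subxx (face q)).
apply: (normal_piola (w := template R (face q) t0)
  (Xdet _ (Om q)) (Xdet' _ (Om q')) (JE 1) (JE 2%:R) (nE 1) (nE 2%:R)).
  by have := nut0 t0; rewrite eqxx.
exact: hdiv_normal_trace hU XP dP ee' ff' lw.
Qed.

End Tetrahedron.

Theorem theorem4p4 (R : realType) (p : nat) (hp : (1 <= p)%N)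
    (U : {set 'I_4} -> nat -> poly3 R) (hU : h1_conforming_basis p U) :
  (* the products form a basis of their span *)
  (forall d, hdiv_comb p U d = 0 ->
     forall s m t, (m < nbase p s)%N -> d s m t = 0) /\
  (* the assembled space is H(div)-conforming *)
  (forall (E : finType) (X : E -> 'rV[R]_3 -> 'rV[R]_3),
     conforming_mesh X ->
     hdiv_space p U X `<=` no_normal_jump X).
Proof.
split=> [d|E X XP]; first exact: hdiv_free hU.
exact: hdiv_no_normal_jump hU XP.
Qed.
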